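(* Let $k$ be a positive integer, let $j\in\{1,\ldots,k\}$, let $G(x)=\sum_{a=1}^k x^a$, let $\phi$ be the unique positive real number with $\sum_{a=1}^k\phi^{-a}=1$, and let $\sigma=1/\phi$. For $n\ge 0$ let $C_{n,j}$ be the total number of occurrences of the part $j$ among all compositions of $n$ whose parts all lie in $\{1,\ldots,k\}$. Then there is a constant $A$ with $0<A<1$ such that \[ C_{n,j}=\frac{\phi^{n+2-j}}{G'(\sigma)^2}(n+1-j)+\frac{\phi^{n+1-j}G''(\sigma)}{G'(\sigma)^3}+O(A^n). \]
   Context: A composition of a nonnegative integer $n$ is a finite sequence of positive integers summing to $n$; its entries are its parts ($0$ has only the empty composition). $G'$, $G''$ are derivatives of $G$. $f(n)=h(n)+O(A^n)$ means there exist $C,N>0$ with $|f(n)-h(n)|\le C A^n$ for all $n>N$. *)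

(* Defs.v *)
From HB Require Import structures.
From mathcomp Require Import all_boot all_order all_algebra.
From mathcomp Require Import all_classical all_reals.

Set Implicit Arguments.
Unset Strict Implicit.
Unset Printing Implicit Defensive.

Import Order.TTheory GRing.Theory Num.Theory.

Local Open Scope classical_set_scope.
Local Open Scope ring_scope.

Definition composition (n : nat) (s : seq nat) : bool :=
  all (fun a => 0 < a)%N s && (sumn s == n).

Definition bounded_compositions (k n : nat) : set (seq nat) :=
  [set s | composition n s && all (fun a => a <= k)%N s].

Lemma composition_size (n : nat) (s : seq nat) :
  composition n s -> (size s <= n)%N.
Proof.
case/andP=> + /eqP<-; elim: s => //= a s IH /andP[a0 /IH le].
by rewrite -add1n leq_add.
Qed.

(* The sum in [part_count] is a finitely supported sum, which would be 0 by
   convention over an infinite support; this lemma rules that case out. *)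
Lemma finite_bounded_compositions (k n : nat) :
  finite_set (bounded_compositions k n).
Proof.
apply: (@sub_finite_set _ _
  ((fun t : {bseq n of 'I_k.+1} => map val t) @` setT)); last first.
  exact/finite_image/finite_finset.
move=> s /andP[/composition_size les /allP lek].
pose u : seq 'I_k.+1 := map inord s.
have leu : (size u <= n)%N by rewrite size_map.
exists (Bseq leu) => //=; rewrite -map_comp -[RHS]map_id.
by apply/eq_in_map => a /lek ak /=; rewrite inordK.
Qed.

Definition part_count (k n j : nat) : nat :=
  \big[addn/0%N]_(s \in bounded_compositions k n) count_mem j s.

Definition Gpoly (R : realType) (k : nat) : {poly R} :=
  \sum_(1 <= a < k.+1) 'X^a.

Definition eq_up_to_O (R : realType) (f h g : nat -> R) : Prop :=
  exists (C : R) (N : nat), [/\ 0 < C, (0 < N)%N &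
    forall n : nat, (N < n)%N -> `|f n - h n| <= C * g n].

(* Main.v *)
(** Let [a] be the generating function of the compositions with parts at most
    [k], so that [(1 - G) a = 1]; splitting off the first part of a composition
    shows that occurrences of [j] have generating function [X^j a^2].  Write
    [1 - G = (1 - phi X) H].  The coefficients of [H] are nonnegative with
    successive ratios at most [phi / 2 < 1], so an Eneström-Kakeya argument
    carried out on coefficients (no complex roots) shows that the coefficients
    of [1 / H] decay like [(phi / 2)^n].  The principal part at the double pole
    [1 / phi] gives [a^2 = c / (1 - phi X)^2 + kappa / (1 - phi X) + S / H^2]
    with [S] a polynomial: the first two terms are the main term, the last one
    is the error. *)
Require Import Defs.
From HB Require Import structures.
From mathcomp Require Import all_boot all_order all_algebra.
From mathcomp Require Import finmap ring lra zify.
From mathcomp Require Import all_classical all_reals.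
Set Implicit Arguments.
Unset Strict Implicit.
Unset Printing Implicit Defensive.

Import Order.TTheory GRing.Theory Num.Theory.
Local Open Scope ring_scope.

(** * Formal power series as a ring under the Cauchy product *)

Definition fps (R : Type) := nat -> R.

Section FpsRing.
Variable R : comNzRingType.
Implicit Types u v w : fps R.

HB.instance Definition _ := GRing.Zmodule.copy (fps R) (nat -> R).

Definition fps_mul u v : fps R := fun n => \sum_(i < n.+1) u i * v (n - i)%N.
Definition fps_one : fps R := fun n => (n == 0)%:R.

(** Coefficients up to [n] only see the truncations at degree [n], so commutativity and
    associativity are inherited from [{poly R}]. *)
Lemma fps_mul_trunc u v n m : (m <= n)%N ->
  fps_mul u v m = (\poly_(i < n.+1) u i * \poly_(i < n.+1) v i)`_m.
Proof.
move=> lemn; rewrite coefM; apply: eq_bigr => i _; rewrite !coef_poly !ltnS.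
by rewrite (leq_trans (leq_subr i m) lemn) (leq_trans (leq_ord i) lemn).
Qed.

Lemma fps_mulC : commutative fps_mul.
Proof.
by move=> u v; apply/funext => n; rewrite !(@fps_mul_trunc _ _ n) // mulrC.
Qed.

Lemma fps_mulA : associative fps_mul.
Proof.
move=> u v w; apply/funext => n.
transitivity (\poly_(i < n.+1) u i *
    (\poly_(i < n.+1) v i * \poly_(i < n.+1) w i))`_n.
  rewrite coefM; apply: eq_bigr => i _.
  by rewrite coef_poly ltn_ord (@fps_mul_trunc _ _ n) // leq_subr.
rewrite mulrA coefM; apply: eq_bigr => i _.
rewrite (@fps_mul_trunc _ _ n) ?leq_ord //; congr (_ * _).
by rewrite coef_poly ltnS leq_subr.
Qed.

Lemma fps_mul1 : left_id fps_one fps_mul.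
Proof.
move=> u; apply/funext => n; rewrite /fps_mul big_ord_recl mul1r subn0.
by rewrite big1 ?addr0 // => i _; rewrite mul0r.
Qed.

Lemma fps_mulDl : left_distributive fps_mul +%R.
Proof.
move=> u v w; apply/funext => n; rewrite /fps_mul.
under eq_bigr do rewrite mulrDl.
by rewrite big_split.
Qed.

Lemma fps_oner_neq0 : fps_one != 0.
Proof. by apply/eqP => /(congr1 (@^~ 0%N)) /eqP; rewrite oner_eq0. Qed.

HB.instance Definition _ := GRing.Zmodule_isComNzRing.Build (fps R)
  fps_mulA fps_mulC fps_mul1 fps_mulDl fps_oner_neq0.

Lemma fpsM u v n : (u * v) n = \sum_(i < n.+1) u i * v (n - i)%N.
Proof. by []. Qed.

Lemma fps1 n : (1 : fps R) n = (n == 0)%:R.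
Proof. by []. Qed.

Lemma fpsD u v n : (u + v) n = u n + v n.
Proof. by []. Qed.

Definition fps_of_poly (p : {poly R}) : fps R := fun n => p`_n.

Lemma fps_of_poly_is_zmod_morphism : zmod_morphism fps_of_poly.
Proof. by move=> p q; apply/funext => n; exact: coefB. Qed.

Lemma fps_of_poly_is_monoid_morphism : monoid_morphism fps_of_poly.
Proof.
by split=> [|p q]; apply/funext => n; [exact: coef1 | exact: coefM].
Qed.

HB.instance Definition _ := GRing.isZmodMorphism.Build {poly R} (fps R)
  fps_of_poly fps_of_poly_is_zmod_morphism.
HB.instance Definition _ := GRing.isMonoidMorphism.Build {poly R} (fps R)
  fps_of_poly fps_of_poly_is_monoid_morphism.

Lemma fps_of_polyZ (a : R) p u n :
  (fps_of_poly (a *: p) * u) n = a * (fps_of_poly p * u) n.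
Proof.
rewrite !fpsM mulr_sumr; apply: eq_bigr => i _.
by rewrite /fps_of_poly coefZ mulrA.
Qed.

Lemma fps_of_polyXnM m u n :
  (fps_of_poly 'X^m * u) n = if (m <= n)%N then u (n - m)%N else 0.
Proof.
rewrite fpsM; case: leqP => [lemn|ltnm]; last first.
  rewrite big1 // => i _; rewrite /fps_of_poly coefXn.
  by rewrite ltn_eqF ?mul0r // (leq_ltn_trans (leq_ord i)).
rewrite (bigD1 (Ordinal (lemn : (m < n.+1)%N))) //= /fps_of_poly coefXn eqxx.
rewrite mul1r.
rewrite big1 ?addr0 // => i; rewrite -val_eqE /= coefXn => /negPf ->.
by rewrite mul0r.
Qed.

Definition fps_geom (x : R) : fps R := fun n => x ^+ n.

Lemma fps_geomP x : fps_of_poly (1 - x *: 'X) * fps_geom x = 1.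
Proof.
apply/funext => -[|n].
  by rewrite fpsM big_ord1 /fps_of_poly coefB coef1 coefZ coefX mulr0 subr0 mulr1.
have -> : fps_of_poly (1 - x *: 'X) * fps_geom x =
    fps_geom x - fps_of_poly (x *: 'X^1) * fps_geom x.
  by rewrite rmorphB rmorph1 mulrBl mul1r.
transitivity (fps_geom x n.+1 - (fps_of_poly (x *: 'X^1) * fps_geom x) n.+1) => //.
by rewrite fps_of_polyZ fps_of_polyXnM subn1 /fps_geom -exprS subrr.
Qed.

Lemma fps_geom_sqr x n : (fps_geom x ^+ 2) n = n.+1%:R * x ^+ n.
Proof.
rewrite expr2 fpsM (eq_bigr (fun=> x ^+ n)) => [|i _].
  by rewrite sumr_const card_ord mulr_natl.
by rewrite /fps_geom -exprD subnKC // leq_ord.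
Qed.

End FpsRing.

(** * Geometric bounds on coefficients *)

Section GeometricDecay.
Variable R : realFieldType.
Implicit Types u v : fps R.

Definition geom_bounded (r : R) u := exists C, forall n, `|u n| <= C * r ^+ n.

Lemma geom_bounded_poly (r : R) (p : {poly R}) :
  0 < r -> geom_bounded r (fps_of_poly p).
Proof.
move=> r0; exists (\sum_(i < size p) `|p`_i| / r ^+ i) => n.
rewrite -ler_pdivrMr ?exprn_gt0 // /fps_of_poly.
have [ltnp|lepn] := ltnP n (size p).
  rewrite (bigD1 (Ordinal ltnp)) //= lerDl sumr_ge0 // => i _.
  by rewrite divr_ge0 ?exprn_ge0 // ltW.
rewrite nth_default // normr0 mul0r sumr_ge0 // => i _.
by rewrite divr_ge0 ?exprn_ge0 // ltW.
Qed.

Lemma geom_boundedW (r s : R) u :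
  0 <= r <= s -> geom_bounded r u -> geom_bounded s u.
Proof.
move=> /andP[r0 rs] [C uC]; exists C => n; apply: (le_trans (uC n)).
have C0 : 0 <= C by have := le_trans (normr_ge0 _) (uC 0); rewrite mulr1.
by rewrite ler_wpM2l // lerXn2r // nnegrE (le_trans r0).
Qed.

(** The strict gap between the rates turns the convolution into [s ^+ n] times a partial sum of the
    convergent geometric series of ratio [r / s]. *)
Lemma geom_boundedM (r s : R) u v : 0 <= r < s ->
  geom_bounded r u -> geom_bounded s v -> geom_bounded s (u * v).
Proof.
move=> /andP[r0 rs] [C uC] [D vD].
have s0 : 0 < s := le_lt_trans r0 rs.
have C0 : 0 <= C by have := le_trans (normr_ge0 _) (uC 0); rewrite mulr1.
have D0 : 0 <= D by have := le_trans (normr_ge0 _) (vD 0); rewrite mulr1.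
have q0 : 0 <= r / s by rewrite divr_ge0 // ltW.
have q1 : 0 < 1 - r / s by rewrite subr_gt0 ltr_pdivrMr // mul1r.
have geo n : \sum_(i < n.+1) (r / s) ^+ i <= (1 - r / s)^-1.
  rewrite -[leRHS]mul1r ler_pdivlMr // mulrC -opprB mulNr -subrX1 opprB.
  by rewrite gerBl exprn_ge0.
exists (C * D / (1 - r / s)) => n; rewrite fpsM.
apply: (le_trans (ler_norm_sum _ _ _)).
apply: (@le_trans _ _ (\sum_(i < n.+1) C * D * s ^+ n * (r / s) ^+ i)).
  apply: ler_sum => i _; rewrite normrM.
  apply: (le_trans (ler_pM _ _ (uC i) (vD (n - i)%N))) => //.
  rewrite expfB_cond; last by rewrite gt_eqF // leq_ord.
  rewrite expr_div_n le_eqVlt; apply/orP; left; apply/eqP.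
  by field; rewrite gt_eqF // exprn_gt0.
by rewrite -mulr_sumr [leRHS]mulrAC ler_wpM2l // !mulr_ge0 // exprn_ge0 // ltW.
Qed.

(* Eneström-Kakeya, on coefficients: multiplying [b * u = 1] by [1 - r X]
   expresses [u n] through earlier terms with the nonnegative weights
   [r b_i - b_(i+1)], whose geometric sum telescopes. *)
Lemma inv_geom_bounded (r : R) (b u : fps R) :
  0 <= r -> (forall i, 0 <= b i) -> b 0 = 1 -> (forall i, b i.+1 <= r * b i) ->
  b * u = 1 -> forall n, `|u n| <= r ^+ n.
Proof.
move=> r0 b_ge0 b0 b_dec bu1.
have u0 : u 0 = 1.
  have := congr1 (@^~ 0%N) bu1.
  by rewrite /= fpsM big_ord1 b0 mul1r.
have recu n : u n.+1 = - \sum_(i < n.+1) b i.+1 * u (n - i)%N.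
  have := congr1 (@^~ n.+1) bu1.
  rewrite /= fpsM big_ord_recl b0 mul1r subn0 fps1 /= => /eqP.
  by rewrite addr_eq0 => /eqP.
have rec0 n : \sum_(i < n.+2) b i * u (n.+1 - i)%N = 0.
  by rewrite -fpsM bu1.
have rec2 n : u n.+2 = \sum_(i < n.+2) (r * b i - b i.+1) * u (n.+1 - i)%N.
  under eq_bigr do rewrite mulrBl -mulrA.
  by rewrite sumrB -mulr_sumr rec0 mulr0 sub0r recu.
have tele n : \sum_(i < n.+1) (r * b i - b i.+1) * r ^+ (n - i) =
    r ^+ n.+1 - b n.+1.
  elim: n => [|n IH]; first by rewrite big_ord1 subnn b0 !mulr1 expr1.
  rewrite big_ord_recr /= subnn mulr1.
  under eq_bigr => i _ do rewrite subSn ?leq_ord // exprS mulrCA.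
  rewrite -mulr_sumr IH !exprS; ring.
(* The product [(1 - r X) * b * u] equals [1 - r X], whose coefficients vanish only from index 2 on;
   indices 0 and 1 are therefore checked by hand. *)
elim/ltn_ind => -[|[|n]] IH.
- by rewrite u0 normr1.
- by rewrite recu big_ord1 subnn u0 mulr1 normrN ger0_norm // expr1 -[r]mulr1 -b0.
- rewrite rec2; apply: (le_trans (ler_norm_sum _ _ _)).
  apply: (@le_trans _ _ (r ^+ n.+2 - b n.+2)); last by rewrite gerBl.
  rewrite -tele ler_sum // => i _; rewrite normrM.
  by rewrite ger0_norm ?subr_ge0 // ler_wpM2l ?subr_ge0 // IH ?ltnS ?leq_subr.
Qed.

End GeometricDecay.

(** * Generating functions of compositions and of part occurrences *)

Lemma fps_sum (R : comNzRingType) I (r : seq I) (P : pred I) (F : I -> fps R) n :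
  (\sum_(i <- r | P i) F i) n = \sum_(i <- r | P i) F i n.
Proof. by elim/big_rec2: _ => // i x u _ <-. Qed.

Section CompositionSeries.
Variables (R : realType) (k : nat).

Definition bcomps n : seq (seq nat) :=
  enum_fset (fset_set (bounded_compositions k n)).

Lemma mem_bcomps n s :
  (s \in bcomps n) = composition n s && all (fun a => a <= k)%N s.
Proof.
rewrite in_fset_set; last exact: finite_bounded_compositions.
by apply/idP/idP; rewrite inE.
Qed.

Lemma perm_bcomps0 : perm_eq (bcomps 0) [:: [::]].
Proof.
apply: uniq_perm => [|//|s]; [exact: fset_uniq | rewrite mem_bcomps inE].
by case: s => [|[|a] s] /=; rewrite /composition /= ?andbF.
Qed.

Lemma perm_bcompsS n : perm_eq (bcomps n.+1)
  [seq a :: t | a <- [seq a <- index_iota 1 k.+1 | (a <= n.+1)%N],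
                t <- bcomps (n.+1 - a)].
Proof.
apply: uniq_perm => [|| s]; first exact: fset_uniq.
- apply: allpairs_uniq_dep => [|a _|[a s] [b t] _ _ /= [-> ->] //].
    by rewrite filter_uniq // iota_uniq.
  exact: fset_uniq.
- rewrite mem_bcomps; apply/idP/allpairsPdep => /= [|[a [t []]]]; last first.
    rewrite mem_filter mem_index_iota mem_bcomps => an + ->.
    by rewrite /composition /=; lia.
  case: s => [//|a t]; rewrite /composition /= => H.
  exists a, t; rewrite mem_filter mem_index_iota mem_bcomps /composition.
  by split=> //; lia.
Qed.

(** Splitting off the first part, for an arbitrary weight: [F = 1] yields the equation for
    [comp_series], and [F = count_mem j] the one for [part_series]. *)
Lemma sum_bcomps (F : seq nat -> R) n :
  \sum_(s <- bcomps n) F s = (n == 0)%:R * F [::] +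
  \sum_(1 <= a < k.+1 | (a <= n)%N) \sum_(s <- bcomps (n - a)) F (a :: s).
Proof.
case: n => [|n].
  rewrite (perm_big _ perm_bcomps0) big_seq1 mul1r big_nat_cond big1 ?addr0 //.
  by move=> a; lia.
rewrite (perm_big _ (perm_bcompsS n)) big_allpairs_dep big_filter.
by rewrite mul0r add0r.
Qed.

Lemma fps_GpolyM (u : fps R) n :
  (fps_of_poly (Gpoly R k) * u) n = \sum_(1 <= a < k.+1 | (a <= n)%N) u (n - a)%N.
Proof.
rewrite rmorph_sum mulr_suml fps_sum [RHS]big_mkcond.
by apply: eq_bigr => a _; rewrite fps_of_polyXnM.
Qed.

Definition comp_series : fps R := fun n => (size (bcomps n))%:R.

Definition part_series j : fps R := fun n => (part_count k n j)%:R.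

Lemma comp_seriesE : fps_of_poly (1 - Gpoly R k) * comp_series = 1.
Proof.
rewrite rmorphB rmorph1 mulrBl mul1r.
apply/eqP; rewrite subr_eq; apply/eqP/funext => n.
rewrite fpsD fps1 fps_GpolyM.
have sizeE m : comp_series m = \sum_(s <- bcomps m) 1.
  by rewrite big_const_seq count_predT iter_addr_0.
by rewrite sizeE sum_bcomps mulr1; congr (_ + _); apply: eq_bigr => a _.
Qed.

(** An occurrence of [j] is either the first part or lies in the remainder, so the series [P]
    satisfies [P = X^j a + G P]. Multiplying [(1 - G) P = X^j a] by [a] solves for [P]. *)
Lemma part_seriesE j : (1 <= j <= k)%N ->
  part_series j = fps_of_poly 'X^j * comp_series ^+ 2.
Proof.
move=> jk.
have partE m : part_series j m = \sum_(s <- bcomps m) (count_mem j s)%:R.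
  rewrite /part_series /part_count fsbig_finite ?natr_sum //.
  exact: finite_bounded_compositions.
have: part_series j =
    fps_of_poly 'X^j * comp_series + fps_of_poly (Gpoly R k) * part_series j.
  apply/funext => n; rewrite fpsD fps_of_polyXnM fps_GpolyM partE sum_bcomps.
  rewrite mulr0 add0r.
  transitivity (\sum_(1 <= a < k.+1 | (a <= n)%N)
      ((a == j)%:R * comp_series (n - a)%N + part_series j (n - a)%N)).
    apply: eq_bigr => a _; rewrite partE /=.
    under eq_bigr do rewrite natrD.
    by rewrite big_split /= big_const_seq count_predT iter_addr_0 mulr_natr.
  rewrite big_split /=; congr (_ + _).
  rewrite big_mkcond (bigD1_seq j) ?iota_uniq ?mem_index_iota //= eqxx mul1r.
  by rewrite big1 ?addr0 // => a /negPf ->; rewrite mul0r if_same.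
move=> partG; have := comp_seriesE.
rewrite rmorphB rmorph1 => compG.
by rewrite -[LHS]mul1r -compG mulrAC mulrBl mul1r {1}partG addrK expr2 mulrA.
Qed.

End CompositionSeries.

(** * Partial fractions at a double pole *)

Lemma double_root_factor (F : fieldType) (p : {poly F}) x :
  p.[x] = 0 -> p^`().[x] = 0 -> exists q, p = q * ('X - x%:P) ^+ 2.
Proof.
move=> /eqP/factor_theorem[q ->].
rewrite derivM derivXsubC !hornerE subrr mulr0 add0r => /eqP.
by case/factor_theorem=> s ->; exists s; rewrite expr2 mulrA.
Qed.

(* The principal part of [1 / ((1 - phi X)^2 H^2)] at its double pole [phi^-1]. *)
Lemma double_pole_principal_part (F : fieldType) (phi : F) (H : {poly F}) :
  let sigma := phi^-1 in
  let h := H.[sigma] in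
  phi != 0 -> h != 0 ->
  exists S : {poly F},
    1 = ((h ^- 2)%:P + (H^`().[sigma] *+ 2 / (phi * h ^+ 3)) *: (1 - phi *: 'X))
          * H ^+ 2
        + S * (1 - phi *: 'X) ^+ 2.
Proof.
move=> sigma h phi0 h0.
(* [c] makes [1 - (c + kappa (1 - phi X)) H^2] vanish at [sigma], and [kappa] makes its derivative
   vanish there. *)
set c := (h ^- 2)%:P; set kappa := _ / _.
have ps : phi * sigma = 1 by rewrite divff.
have hE : H.[sigma] = h by [].
have [|| q qE] := @double_root_factor _
    (1 - (c + kappa *: (1 - phi *: 'X)) * H ^+ 2) sigma.
- rewrite /c !(hornerD, hornerN, hornerM, hornerZ, hornerC, hornerX, horner_exp).
  by rewrite ps hE; field.
- rewrite /c !derivE !(hornerD, hornerN, hornerM, hornerZ, hornerC, hornerX,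
    horner_exp, hornerMn) hE ps /kappa.
  by field; rewrite phi0 h0.
(* The factor [phi ^- 2] compensates for [(1 - phi X)^2 = phi^2 (X - sigma)^2]. *)
exists (phi ^- 2 *: q); apply/eqP; rewrite addrC -subr_eq qE; apply/eqP.
have -> : 1 - phi *: 'X = - phi *: ('X - sigma%:P).
  by rewrite scalerBr !scaleNr opprK -[sigma%:P]alg_polyC scalerA ps scale1r addrC.
rewrite exprZn sqrrN -scalerAl -scalerAr scalerA mulVf ?scale1r //.
by rewrite expf_neq0.
Qed.

(** * The cofactor of [1 - phi X] in [1 - G] *)

Section QuotientPolynomial.
Variables (R : realType) (k : nat) (phi : R).
Hypotheses (phi_gt0 : 0 < phi) (hphi : \sum_(1 <= a < k.+1) phi ^- a = 1).

(** Dividing [1 - G] by [1 - phi X] gives, for [i <= k], the coefficient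
    [phi^i (1 - sum_{a <= i} phi^-a)]. By [hphi] this is the sum below, visibly nonnegative; the
    range is empty once [i >= k]. *)
Definition quot_coef i := \sum_(1 <= a < k.+1 - i) phi ^- a.

Lemma quot_coef_ge0 i : 0 <= quot_coef i.
Proof. by apply: sumr_ge0 => a _; rewrite invr_ge0 exprn_ge0 // ltW. Qed.

Lemma quot_coef0 : quot_coef 0 = 1.
Proof. by rewrite /quot_coef subn0. Qed.

Lemma quot_coef_eq0 i : (k <= i)%N -> quot_coef i = 0.
Proof. by move=> ki; rewrite /quot_coef big_geq // leq_subLR addn1 ltnS. Qed.

Lemma quot_coefS i : (i < k)%N -> quot_coef i.+1 = phi * quot_coef i - 1.
Proof.
move=> ik; rewrite /quot_coef (_ : k.+1 - i = (k - i.+1).+2)%N; last lia.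
rewrite subSS big_add1 /= mulr_sumr.
have -> : (k - i = (k - i.+1).+1)%N by lia.
rewrite big_add1 /= [in RHS]big_nat_recl // expr1 divff ?gt_eqF //.
rewrite addrAC subrr add0r; apply: eq_bigr => a _.
by rewrite [in RHS]exprS invfM mulrA divff ?gt_eqF // mul1r.
Qed.

Lemma quot_coef_le1 i : quot_coef i <= 1.
Proof.
elim: i => [|i IH]; first by rewrite quot_coef0.
apply: le_trans IH; have [ki|ik] := leqP k i.
  by rewrite !quot_coef_eq0 // (leq_trans ki).
rewrite {2}/quot_coef subSn ?big_nat_recr /= ?subSS; try lia.
by rewrite lerDl invr_ge0 exprn_ge0 // ltW.
Qed.

(** If [phi >= 2], the recurrence [b_(i+1) = phi b_i - 1] started at 1 would keep every coefficient
    at least 1, up to [b_k = 0]. *)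
Lemma phi_lt2 : phi < 2.
Proof.
rewrite ltNge; apply/negP => phi2.
have ge1 i : (i <= k)%N -> 1 <= quot_coef i.
  elim: i => [|i IH] ik; first by rewrite quot_coef0.
  rewrite quot_coefS //; have := IH (ltnW ik); nra.
by have := ge1 k (leqnn k); rewrite quot_coef_eq0 // ler10.
Qed.

(** For [i < k] the recurrence reduces this to [phi b_i <= 2], which follows from [b_i <= 1] and
    [phi < 2]. *)
Lemma quot_coef_ratio i : quot_coef i.+1 <= phi / 2 * quot_coef i.
Proof.
have [ki|ik] := leqP k i; first by rewrite !quot_coef_eq0 ?mulr0 // ltnW.
rewrite quot_coefS //.
have := quot_coef_le1 i; have := quot_coef_ge0 i; have := phi_lt2; nra.
Qed.

Definition quot_poly : {poly R} := \poly_(i < k) quot_coef i.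

Lemma coef_quot_poly i : quot_poly`_i = quot_coef i.
Proof. by rewrite coef_poly; case: ltnP => // /quot_coef_eq0. Qed.

Lemma quot_polyE : (1 - phi *: 'X) * quot_poly = 1 - Gpoly R k.
Proof.
apply/polyP => i; rewrite mulrBl mul1r -scalerAl !coefB coefZ coefXM coef1.
rewrite coef_sum !coef_quot_poly.
under eq_bigr do rewrite coefXn.
case: i => [|i] /=.
  rewrite mulr0 subr0 quot_coef0 big_nat_cond big1 ?subr0 // => a /andP[].
  by case: a.
have [ki|ik] := leqP k i.
  rewrite !quot_coef_eq0 ?mulr0 ?subr0 ?sub0r; try lia.
  rewrite big_nat_cond big1 ?oppr0 // => a /andP[ak _].
  by rewrite gtn_eqF //; lia.
rewrite (bigD1_seq i.+1) ?iota_uniq ?mem_index_iota //= eqxx.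
rewrite big1 => [|a /negPf]; last by rewrite eq_sym => ->.
by rewrite quot_coefS // addr0 sub0r addrAC subrr add0r.
Qed.

Lemma quot_poly_gt0 x : 0 <= x -> 0 < quot_poly.[x].
Proof.
move=> x0.
have k0 : (0 < k)%N.
  rewrite lt0n; apply/eqP => k0; move/eqP: hphi.
  by rewrite k0 big_geq // eq_sym oner_eq0.
rewrite horner_poly (bigD1 (Ordinal k0)) //= quot_coef0 mulr1 ltr_pwDl //.
by apply: sumr_ge0 => i _; rewrite mulr_ge0 ?exprn_ge0 ?quot_coef_ge0.
Qed.

End QuotientPolynomial.

(** * Assembling the asymptotic formula *)

(** The partial fraction identity is multiplied by [(U V)^2], with [U] and [V] standing for the
    power series [1 / H] and [1 / w]. *)
Lemma sqr_split (A : comPzRingType) (c kappa w H S U V : A) :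
  w * V = 1 -> H * U = 1 -> 1 = (c + kappa * w) * H ^+ 2 + S * w ^+ 2 ->
  (U * V) ^+ 2 = c * V ^+ 2 + kappa * V + S * U ^+ 2.
Proof.
move=> wV HU pp; rewrite -[LHS]mul1r pp.
transitivity (c * V ^+ 2 * (H * U) ^+ 2 + kappa * V * (w * V) * (H * U) ^+ 2
              + S * U ^+ 2 * (w * V) ^+ 2); first by ring.
by rewrite wV HU !expr1n !mulr1.
Qed.

Theorem theorem4p8 (R : realType) (k j : nat) (phi : R)
    (hk : (0 < k)%N) (hj : (1 <= j <= k)%N)
    (phi_gt0 : 0 < phi)
    (hphi : \sum_(1 <= a < k.+1) phi ^- a = 1) :
  let G := Gpoly R k in
  let sigma := phi^-1 in
  exists A : R, [/\ 0 < A, A < 1 &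
    eq_up_to_O
      (fun n : nat => (part_count k n j)%:R)
      (fun n : nat =>
         phi ^ (n%:Z + 2 - j%:Z) / G^`().[sigma] ^+ 2 * (n%:R + 1 - j%:R)
         + phi ^ (n%:Z + 1 - j%:Z) * G^`()^`().[sigma] / G^`().[sigma] ^+ 3)
      (fun n : nat => A ^+ n)].
Proof.
move=> G sigma.
have phi0 : phi != 0 by rewrite gt_eqF.
have ps : phi * sigma = 1 by rewrite divff.
have s0 : 0 <= sigma by rewrite invr_ge0 ltW.
set H := quot_poly k phi; set h := H.[sigma].
have h0 : h != 0 by rewrite gt_eqF // quot_poly_gt0.
have GE : G = 1 - (1 - phi *: 'X) * H by rewrite quot_polyE // opprB addrC subrK.
(* In the derivatives of [G = 1 - (1 - phi X) H] at [sigma], only terms where the linear factor has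
   been differentiated survive. *)
have G'E : G^`().[sigma] = phi * h.
  rewrite GE !derivE !(hornerD, hornerN, hornerM, hornerZ, hornerC, hornerX).
  by rewrite ps -/h; ring.
have G''E : G^`()^`().[sigma] = phi * H^`().[sigma] *+ 2.
  rewrite GE !derivE !(hornerD, hornerN, hornerM, hornerZ, hornerC, hornerX).
  by rewrite ps -/h; ring.
have [S] := double_pole_principal_part phi0 h0.
rewrite -/sigma -/h; set kappa := _ / _ => ppE.
(* Defining [U] as [w * a] provides the inverse of [H] directly, since [H w = 1 - G] and
   [(1 - G) a = 1]. *)
pose w := fps_of_poly (1 - phi *: 'X).
pose a := comp_series R k; pose V := fps_geom phi; pose U := w * a.
have wV : w * V = 1 := fps_geomP phi.
have HU : fps_of_poly H * U = 1.
  by rewrite mulrCA mulrA -rmorphM quot_polyE // comp_seriesE.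
pose r := phi / 2; pose A := (1 + r) / 2.
have r0 : 0 < r by rewrite divr_gt0.
have r1 : r < 1 by rewrite ltr_pdivrMr // mul1r (phi_lt2 phi_gt0 hphi).
have rA : r < A by rewrite /A; lra.
have Ugb : geom_bounded r U.
  exists 1 => n; rewrite mul1r.
  apply: (@inv_geom_bounded _ r (fps_of_poly H)) => //.
  - exact: ltW.
  - by move=> i; rewrite /fps_of_poly coef_quot_poly; exact: (quot_coef_ge0 k phi_gt0).
  - by rewrite /fps_of_poly coef_quot_poly; exact: (quot_coef0 hphi).
  - by move=> i; rewrite /fps_of_poly !coef_quot_poly; exact: (quot_coef_ratio phi_gt0 hphi).
(* Each product needs a strict gap between rates. The polynomial [S] is bounded at rate [r / 2], so
   [S * U] keeps rate [r]; the second factor [U] raises it to [A], the midpoint of [r] and 1. *)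
have [C EC] : geom_bounded A (fps_of_poly S * U ^+ 2).
  rewrite expr2 mulrA mulrC; apply: (@geom_boundedM _ r) => //.
    by rewrite ltW.
  apply: (@geom_boundedW _ r); first by rewrite ltW //= ltW.
  apply: (@geom_boundedM _ (r / 2)) => //; first by apply/andP; split; lra.
  by apply: geom_bounded_poly; rewrite divr_gt0.
have C0 : 0 <= C by have := le_trans (normr_ge0 _) (EC 0); rewrite mulr1.
have aE : a ^+ 2 = fps_of_poly (h ^- 2 *: 1) * V ^+ 2 +
    fps_of_poly (kappa *: 1) * V + fps_of_poly S * U ^+ 2.
  have -> : a = U * V by rewrite mulrAC wV mul1r.
  apply: (sqr_split wV HU); rewrite /w -!rmorphXn -!rmorphM -rmorphD -rmorphM.
  by rewrite -rmorphD -scalerAl mul1r alg_polyC -ppE rmorph1.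
have A0 : 0 < A by lra.
exists A; split; [by []|by rewrite /A; lra|].
(* Division by [A ^+ j] absorbs the shift by [X^j], and [+ 1] ensures positivity when [C = 0]. The
   threshold [j] makes [n - j] a genuine subtraction. *)
exists (C / A ^+ j + 1), j; split.
- by rewrite ltr_wpDl // divr_ge0 // exprn_ge0 // ltW.
- by case/andP: hj.
move=> n jn; have := part_seriesE R hj => /(congr1 (@^~ n)).
rewrite /= fps_of_polyXnM (ltnW jn) -/a aE.
rewrite /part_series => ->.
rewrite G'E G''E.
set m := (n - j)%N.
have nE : n = (m + j)%N by rewrite subnK // ltnW.
have -> : n%:Z + 2 - j%:Z = m.+2%:Z by lia.
have -> : n%:Z + 1 - j%:Z = m.+1%:Z by lia.
have -> : n%:R + 1 - j%:R = m.+1%:R :> R by rewrite nE natrD -natr1; ring.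
rewrite !fpsD !fps_of_polyZ rmorph1 !mul1r fps_geom_sqr /V /fps_geom -!exprnP.
set e := (_ * U ^+ 2) m.
(* The polar terms equal the claimed main term exactly, leaving only the coefficient [e] of
   [S U^2]. *)
have -> : h ^- 2 * (m.+1%:R * phi ^+ m) + kappa * phi ^+ m + e -
    (phi ^+ m.+2 / (phi * h) ^+ 2 * m.+1%:R +
     phi ^+ m.+1 * (phi * H^`().[sigma] *+ 2) / (phi * h) ^+ 3) = e.
  by rewrite /kappa !exprS; field; rewrite phi0 h0.
apply: (le_trans (EC m)).
have -> : C * A ^+ m = C / A ^+ j * A ^+ n.
  by rewrite nE exprD; field; rewrite expf_neq0 // gt_eqF.
by rewrite ler_wpM2r ?lerDl // exprn_ge0 // ltW.
Qed.
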